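(* Let $v$ be a valuation on a real field $K$ and let $P$ be an ordering of $K$. Take $T=P\cap\mathcal O_v^\times$ and consider the factor hyperfield $K_T$ with the valuation $v_T$ induced by $v$ and the ordering $P_T$ induced by $P$. Then: (i) The valuation $v$ is compatible with $P$ if and only if $v_T$ is compatible with $P_T$. (ii) If $v$ is a rank $1$ valuation which is not compatible with $P$, then any two elements of $K_T$ which are positive (with respect to $P_T$, i.e. lie in $P_T$) are not comparable in the relation $<$ defined by $x<y\iff y-x\subseteq P_T$. In particular, $\mathcal O_{v_T}$ is convex with respect to $P_T$, while $v_T$ is not compatible with $P_T$.
   Context: A hyperoperation $+$ on a nonempty set $H$ assigns to each $(x,y)\in H\times H$ a nonempty subset $x+y\subseteq H$; for subsets, $A+B=\bigcup_{a\in A,b\in B}(a+b)$, and elements are identified with singletons. A canonical hypergroup is $(H,+,0)$ with $+$ an associative and commutative hyperoperation such that for every $x$ there is a unique $-x$ with $0\in x+(-x)$, and $z\in x+y$ implies $y\in z-x:=z+(-x)$. A hyperring is $(R,+,\cdot,0)$ with $(R,+,0)$ a canonical hypergroup, $(R,\cdot)$ a commutative semigroup with $x\cdot 0=0$, and $x(y+z)=xy+xz$ as sets. A hyperfield is a hyperring $F$ with unity $1\neq 0$ such that $F^\times=F\setminus\{0\}$ is a group under multiplication. Every field is a hyperfield with single-valued addition. An ordering of a hyperfield (or field) $F$ is a subset $P\subseteq F$ with $P+P\subseteq P$, $P\cdot P\subseteq P$, $P\cap -P=\emptyset$, $P\cup -P=F^\times$; $F$ is real if it has an ordering. The associated relation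 is $a<b\iff b-a\subseteq P$. A subset $C\subseteq F$ is convex with respect to $P$ if $a,b\in C$ and $a<x<b$ imply $x\in C$. A valuation on $F$ is a map $v:F\to\Gamma\cup\{\infty\}$, $\Gamma$ a (linearly) ordered abelian group written additively, with: $v(a)=\infty$ iff $a=0$; $v(ab)=v(a)+v(b)$; $c\in a+b\Rightarrow v(c)\ge\min\{v(a),v(b)\}$. Put $\mathcal O_v=\{x: v(x)\ge 0\}$, $\mathcal M_v=\{x: v(x)>0\}$, $\mathcal O_v^\times=\{x: v(x)=0\}$. A valuation has rank 1 if its value group $v(F^\times)$ is nontrivial and archimedean. Compatibility: $v$ and an ordering $P$ of $F$ are compatible if $1+\mathcal M_v\subseteq P$ (one of several equivalent conditions by which the paper defines compatibility). Factor hyperfield: for a field $K$ and a subgroup $T\le K^\times$, $K_T=\{[x]_T: x\in K\}$ where $[x]_T=xT$, with $[x]_T+[y]_T=\{[xt+yu]_T: t,u\in T\}$ and $[x]_T\cdot[y]_T=[xy]_T$; this is a hyperfield. If $T\subseteq\mathcal O_v^\times$, the induced valuation is $v_T([a]_T)=v(a)$; if $T\subseteq P$, the induced ordering is $P_T=\{[c]_T: c\in P\}$. *)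

(* Defs.v *)
From HB Require Import structures.
From mathcomp Require Import all_boot all_order all_algebra.
From mathcomp Require Import boolp classical_sets.

Set Implicit Arguments.
Unset Strict Implicit.
Unset Printing Implicit Defensive.

Import Order.TTheory GRing.Theory Num.Theory.

Local Open Scope classical_set_scope.
Local Open Scope ring_scope.

(** * Linearly ordered abelian groups *)

(* [porderZmodType] does not relate the order to the addition; totality is part
   of the mixin, as inheriting [Order.Total] here would break the joins of the
   existing hierarchy. *)
HB.mixin Record POrderedZmodule_isOrderedGroup G
    of Num.POrderedZmodule G := {
  og_total : forall x y : G, (x <= y) || (y <= x);
  og_leD2r : forall x y z : G, x <= y -> x + z <= y + z
}.

#[short(type="orderedGroupType")]
HB.structure Definition OrderedGroup :=
  {G of Num.POrderedZmodule G & POrderedZmodule_isOrderedGroup G}.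

(** [option G] is G with a greatest element oo = [None] adjoined. *)
Section Infinity.
Variable G : orderedGroupType.

Definition vle (a b : option G) : bool :=
  match a, b with
  | _, None => true
  | None, Some _ => false
  | Some x, Some y => x <= y
  end.

Definition vlt (a b : option G) : bool := ~~ vle b a.

Definition vmin (a b : option G) : option G := if vle a b then a else b.

Definition vadd (a b : option G) : option G :=
  match a, b with
  | Some x, Some y => Some (x + y)
  | _, _ => None
  end.

End Infinity.

(** * Hyperfields *)

Definition hsum (H : Type) (add : H -> H -> set H) (A B : set H) : set H :=
  \bigcup_(a in A) \bigcup_(b in B) add a b.

Declare Scope hyper_scope.
Delimit Scope hyper_scope with H.

HB.mixin Record isCanonicalHypergroup H := {
  hzero : H;
  hopp : H -> H;
  hadd : H -> H -> set H;
  hadd_nonempty : forall x y, hadd x y !=set0;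
  haddA : forall x y z,
    hsum hadd (hadd x y) [set z] = hsum hadd [set x] (hadd y z);
  haddC : forall x y, hadd x y = hadd y x;
  haddN : forall x, hadd x (hopp x) hzero;
  haddN_uniq : forall x y, hadd x y hzero -> y = hopp x;
  hadd_rev : forall x y z, hadd x y z -> hadd z (hopp x) y
}.

#[short(type="canonicalHypergroupType")]
HB.structure Definition CanonicalHypergroup := {H of isCanonicalHypergroup H}.

HB.mixin Record CanonicalHypergroup_isHyperring R of CanonicalHypergroup R := {
  hmul : R -> R -> R;
  hmulA : forall x y z, hmul x (hmul y z) = hmul (hmul x y) z;
  hmulC : forall x y, hmul x y = hmul y x;
  hmul0 : forall x, hmul x hzero = hzero;
  hmulDr : forall x y z,
    [set hmul x w | w in hadd y z] = hadd (hmul x y) (hmul x z)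
}.

#[short(type="hyperringType")]
HB.structure Definition Hyperring :=
  {R of CanonicalHypergroup R & CanonicalHypergroup_isHyperring R}.

(* Closure of the nonzero elements under [hmul] and inversion follows. *)
HB.mixin Record Hyperring_isHyperfield F of Hyperring F := {
  hone : F;
  hmul1 : forall x, hmul x hone = x;
  hone_neq0 : hone <> hzero :> F;
  hmul_inv : forall x, x <> hzero -> exists y, hmul x y = hone
}.

#[short(type="hyperfieldType")]
HB.structure Definition Hyperfield :=
  {F of Hyperring F & Hyperring_isHyperfield F}.

Notation "0" := (@hzero _) : hyper_scope.
Notation "1" := (@hone _) : hyper_scope.
Notation "- x" := (hopp x) : hyper_scope.
Notation "x + y" := (hadd x y) : hyper_scope.
Notation "x - y" := (hadd x (hopp y)) : hyper_scope.
Notation "x * y" := (hmul x y) : hyper_scope.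
Bind Scope hyper_scope with CanonicalHypergroup.sort.
Bind Scope hyper_scope with Hyperring.sort.
Bind Scope hyper_scope with Hyperfield.sort.

(** * Orderings and valuations of hyperfields *)

Record ordering (F : hyperfieldType) := Ordering {
  positive :> set F;
  ordD : hsum hadd positive positive `<=` positive;
  ordM : forall x y, positive x -> positive y -> positive (x * y)%H;
  ord_disj : positive `&` [set (- x)%H | x in positive] = set0;
  ord_cover : positive `|` [set (- x)%H | x in positive]
              = [set x | x <> 0%H]
}.

Record valuation (F : hyperfieldType) (G : orderedGroupType) := Valuation {
  val_fun :> F -> option G;
  val_oo : forall a, val_fun a = None <-> a = 0%H;
  valM : forall a b, val_fun (a * b)%H = vadd (val_fun a) (val_fun b);
  valD : forall a b c, (a + b)%H c ->
    vle (vmin (val_fun a) (val_fun b)) (val_fun c)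
}.

Section OrderValuation.
Variables (F : hyperfieldType) (G : orderedGroupType).
Implicit Types (P : ordering F) (v : valuation F G).

Definition hlt P (a b : F) : Prop := (b - a)%H `<=` P.

Definition hcomparable P (a b : F) : Prop := hlt P a b \/ hlt P b a.

Definition order_convex P (C : set F) : Prop :=
  forall a b x, C a -> C b -> hlt P a x -> hlt P x b -> C x.

Definition val_ring v : set F := [set x | vle (Some 0) (v x)].
Definition val_ideal v : set F := [set x | vlt (Some 0) (v x)].
Definition val_units v : set F := [set x | v x = Some 0].

Definition value_group v : set G :=
  [set g | exists2 x, x <> 0%H & v x = Some g].

Definition rank1 v : Prop :=
  (exists2 g, value_group v g & g <> 0) /\
  (forall g h, value_group v g -> value_group v h -> 0 < g ->
     exists n : nat, h <= g *+ n).

Definition compatible v P : Prop :=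
  hsum hadd [set 1%H] (val_ideal v) `<=` P.

End OrderValuation.

(** * Fields as hyperfields *)

Definition field_hyper (K : Type) : Type := K.

Section FieldHyper.
Variable K : fieldType.
Implicit Types x y z : K.

Definition fadd x y : set K := [set x + y].

Lemma fadd_nonempty x y : fadd x y !=set0.
Proof. by exists (x + y). Qed.

Lemma fsum_set1l x (A : set K) : hsum fadd [set x] A = [set x + a | a in A].
Proof.
apply/seteqP; split=> z.
  by case=> _ -> [a Aa ->]; exists a.
by case=> a Aa <-; exists x => //; exists a.
Qed.

Lemma faddC x y : fadd x y = fadd y x.
Proof. by rewrite /fadd addrC. Qed.

Lemma faddA x y z :
  hsum fadd (fadd x y) [set z] = hsum fadd [set x] (fadd y z).
Proof. by rewrite /fadd !fsum_set1l !image_set1 addrA. Qed.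

Lemma faddN x : fadd x (- x) 0.
Proof. by rewrite /fadd /= subrr. Qed.

Lemma faddN_uniq x y : fadd x y 0 -> y = - x.
Proof. by rewrite /fadd /= => e; apply/eqP; rewrite -addr_eq0 addrC -e. Qed.

Lemma fadd_rev x y z : fadd x y z -> fadd z (- x) y.
Proof. by rewrite /fadd /= => ->; rewrite addrC addKr. Qed.

HB.instance Definition _ := isCanonicalHypergroup.Build (field_hyper K)
  fadd_nonempty faddA faddC faddN faddN_uniq fadd_rev.

Lemma fmulDr x y z : [set x * w | w in fadd y z] = fadd (x * y) (x * z).
Proof. by rewrite /fadd image_set1 mulrDr. Qed.

HB.instance Definition _ := CanonicalHypergroup_isHyperring.Build (field_hyper K)
  (@mulrA K) (@mulrC K) (@mulr0 K) fmulDr.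

Lemma fone_neq0 : 1 <> 0 :> K.
Proof. by apply/eqP; rewrite oner_eq0. Qed.

Lemma fmul_inv x : x <> 0 -> exists y, x * y = 1.
Proof. by move/eqP=> x0; exists x^-1; rewrite divff. Qed.

HB.instance Definition _ := Hyperring_isHyperfield.Build (field_hyper K)
  (@mulr1 K) fone_neq0 fmul_inv.

End FieldHyper.

(** * Factor hyperfields *)

Record mulSubgroup (K : fieldType) := MulSubgroup {
  subgroup_set :> set K;
  subgroup0 : ~ subgroup_set 0;
  subgroup1 : subgroup_set 1;
  subgroupM : forall x y,
    subgroup_set x -> subgroup_set y -> subgroup_set (x * y);
  subgroupV : forall x, subgroup_set x -> subgroup_set x^-1
}.

Section Factor.
Variables (K : fieldType) (sT : mulSubgroup K).
Local Notation T := (subgroup_set sT).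
Implicit Types (x y z t u : K).

Definition coset x : set K := [set x * t | t in T].

Definition factor : Type := {A : set K | exists x, A = coset x}.

Implicit Types A B C : factor.

Definition cls x : factor := exist _ (coset x) (ex_intro _ x erefl).

Definition rep A : K := projT1 (cid (svalP A)).

Lemma repK A : cls (rep A) = A.
Proof.
rewrite /rep; case: cid => x /=; case: A => A exA /= eA.
exact/eq_exist/esym.
Qed.

Lemma subgroup_neq0 t : T t -> t != 0.
Proof. by move=> Tt; apply/eqP => t0; apply: (@subgroup0 _ sT); rewrite -t0. Qed.

Lemma clsP x y : cls x = cls y <-> exists2 t, T t & y = x * t.
Proof.
split=> [[] e|[t Tt ->]].
  have : coset y y by exists 1; [exact: subgroup1|rewrite mulr1].
  by rewrite -e => -[t Tt <-]; exists t.
apply: eq_exist; apply/seteqP; split=> z [u Tu <-].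
  exists (t^-1 * u); first by apply: subgroupM => //; exact: subgroupV.
  by rewrite -mulrA mulVKf// subgroup_neq0.
by exists (t * u); [exact: subgroupM|rewrite mulrA].
Qed.

Lemma clsM x t : T t -> cls (x * t) = cls x.
Proof. by move=> Tt; apply/esym/clsP; exists t. Qed.

Lemma rep_cls x : exists2 t, T t & rep (cls x) = x * t.
Proof. by apply/clsP; rewrite repK. Qed.

Definition qzero : factor := cls 0.
Definition qone : factor := cls 1.
Definition qopp A : factor := cls (- rep A).
Definition qmul A B : factor := cls (rep A * rep B).
(* Independent of the chosen representatives: see [qadd_cls]. *)
Definition qadd A B : set factor :=
  [set C | exists t u, [/\ T t, T u & C = cls (rep A * t + rep B * u)]].

Lemma qopp_cls x : qopp (cls x) = cls (- x).
Proof. by rewrite /qopp; have [t Tt ->] := rep_cls x; rewrite -mulNr clsM. Qed.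

Lemma qmul_cls x y : qmul (cls x) (cls y) = cls (x * y).
Proof.
rewrite /qmul; have [t Tt ->] := rep_cls x; have [u Tu ->] := rep_cls y.
by rewrite mulrACA (clsM (x * y))//; exact: subgroupM.
Qed.

Lemma qadd_cls x y : qadd (cls x) (cls y) =
  [set C | exists t u, [/\ T t, T u & C = cls (x * t + y * u)]].
Proof.
have [a Ta ea] := rep_cls x; have [b Tb eb] := rep_cls y.
apply/seteqP; rewrite /qadd ea eb; split=> C [t [u [Tt Tu ->]]].
  by exists (a * t), (b * u); split; rewrite ?mulrA//; apply: subgroupM.
exists (a^-1 * t), (b^-1 * u); split.
- by apply: subgroupM => //; exact: subgroupV.
- by apply: subgroupM => //; exact: subgroupV.
- by rewrite -!mulrA !mulVKf ?subgroup_neq0.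
Qed.

Lemma cls_eq0 x : cls x = qzero -> x = 0.
Proof. by move/esym/clsP => [t _ ->]; rewrite mul0r. Qed.

Lemma qadd_nonempty A B : qadd A B !=set0.
Proof.
exists (cls (rep A * 1 + rep B * 1)); exists 1, 1.
by split=> //; exact: subgroup1.
Qed.

Lemma qaddC A B : qadd A B = qadd B A.
Proof.
by apply/seteqP; split=> C [t [u [Tt Tu ->]]]; exists u, t; rewrite addrC.
Qed.

Lemma qaddA A B C : hsum qadd (qadd A B) [set C] = hsum qadd [set A] (qadd B C).
Proof.
rewrite -(repK A) -(repK B) -(repK C).
set x := rep A; set y := rep B; set z := rep C.
apply/seteqP; split=> D.
  case=> E; rewrite qadd_cls => -[t [u [Tt Tu ->]]] [F ->].
  rewrite qadd_cls => -[t' [u' [Tt' Tu' ->]]].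
  exists (cls x) => //; exists (cls (y * (u * t') + z * u')).
    by rewrite qadd_cls; exists (u * t'), u'; split => //; exact: subgroupM.
  rewrite qadd_cls; exists (t * t'), 1; split; [exact: subgroupM|exact: subgroup1|].
  by rewrite mulr1 mulrDl -!mulrA addrA.
case=> E -> [F]; rewrite qadd_cls => -[t [u [Tt Tu ->]]].
rewrite qadd_cls => -[t' [u' [Tt' Tu' ->]]].
exists (cls (x * t' + y * (t * u'))).
  by rewrite qadd_cls; exists t', (t * u'); split => //; exact: subgroupM.
exists (cls z) => //.
rewrite qadd_cls; exists 1, (u * u'); split; [exact: subgroup1|exact: subgroupM|].
by rewrite mulr1 mulrDl -!mulrA addrA.
Qed.

Lemma qaddN A : qadd A (qopp A) qzero.
Proof.
rewrite -(repK A) qopp_cls qadd_cls; exists 1, 1.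
by split; rewrite ?mulr1 ?subrr//; exact: subgroup1.
Qed.

Lemma qaddN_uniq A B : qadd A B qzero -> B = qopp A.
Proof.
rewrite -(repK A) -(repK B); set x := rep A; set y := rep B.
rewrite qopp_cls qadd_cls => -[t [u [Tt Tu /esym/cls_eq0 /eqP]]].
rewrite addr_eq0 => /eqP e.
by rewrite -(clsM y Tu) -(clsM (- x) Tt) mulNr e opprK.
Qed.

Lemma qadd_rev A B C : qadd A B C -> qadd C (qopp A) B.
Proof.
rewrite -(repK A) -(repK B); set x := rep A; set y := rep B.
rewrite qopp_cls qadd_cls => -[t [u [Tt Tu ->]]].
rewrite qadd_cls; exists 1, t; split=> //; first exact: subgroup1.
by rewrite mulr1 mulNr addrAC subrr add0r clsM.
Qed.

HB.instance Definition _ := isCanonicalHypergroup.Build factor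
  qadd_nonempty qaddA qaddC qaddN qaddN_uniq qadd_rev.

Lemma qmulA A B C : qmul A (qmul B C) = qmul (qmul A B) C.
Proof. by rewrite -(repK A) -(repK B) -(repK C) !qmul_cls mulrA. Qed.

Lemma qmulC A B : qmul A B = qmul B A.
Proof. by rewrite /qmul mulrC. Qed.

Lemma qmul0 A : qmul A qzero = qzero.
Proof. by rewrite -(repK A) qmul_cls mulr0. Qed.

Lemma qmulDr A B C :
  [set qmul A W | W in qadd B C] = qadd (qmul A B) (qmul A C).
Proof.
rewrite -(repK A) -(repK B) -(repK C) !qmul_cls !qadd_cls.
apply/seteqP; split=> D.
  case=> _ [t [u [Tt Tu ->]]] <-; exists t, u; split=> //.
  by rewrite qmul_cls mulrDr !mulrA.
case=> t [u [Tt Tu ->]]; exists (cls (rep B * t + rep C * u)).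
  by exists t, u.
by rewrite qmul_cls mulrDr !mulrA.
Qed.

HB.instance Definition _ := CanonicalHypergroup_isHyperring.Build factor
  qmulA qmulC qmul0 qmulDr.

Lemma qmul1 A : qmul A qone = A.
Proof. by rewrite -(repK A) qmul_cls mulr1. Qed.

Lemma qone_neq0 : qone <> qzero.
Proof. by move/cls_eq0/eqP; rewrite oner_eq0. Qed.

Lemma qmul_inv A : A <> qzero -> exists B, qmul A B = qone.
Proof.
rewrite -(repK A) => A0; exists (cls (rep A)^-1).
by rewrite qmul_cls divff//; apply/eqP => r0; apply: A0; rewrite r0.
Qed.

HB.instance Definition _ := Hyperring_isHyperfield.Build factor
  qmul1 qone_neq0 qmul_inv.

(** ** Induced valuation and ordering *)

Variables (G : orderedGroupType) (v : valuation (field_hyper K) G).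
Variable oP : ordering (field_hyper K).
Local Notation P := (positive oP).
Hypothesis T_units : T `<=` val_units v.
Hypothesis T_pos : T `<=` P.

Definition ival A : option G := v (rep A).

Lemma ival_cls x : ival (cls x) = v x.
Proof.
rewrite /ival; have [t Tt ->] := rep_cls x.
have /= := valM v x t; rewrite (T_units Tt) => ->.
by case: (v x) => //= g; rewrite addr0.
Qed.

Lemma ival_oo A : ival A = None <-> A = qzero.
Proof.
rewrite -(repK A) ival_cls; split=> [/val_oo -> //|/cls_eq0 ->].
exact/val_oo.
Qed.

Lemma ivalM A B : ival (qmul A B) = vadd (ival A) (ival B).
Proof. by rewrite -(repK A) -(repK B) qmul_cls !ival_cls; exact: valM. Qed.

Lemma ivalD A B C : qadd A B C -> vle (vmin (ival A) (ival B)) (ival C).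
Proof.
rewrite -(repK A) -(repK B) qadd_cls => -[t [u [Tt Tu ->]]].
rewrite -(clsM (rep A) Tt) -(clsM (rep B) Tu) !ival_cls.
exact: (@valD _ _ v).
Qed.

Definition induced_valuation : valuation factor G :=
  @Valuation factor G ival ival_oo ivalM ivalD.

Definition ipos : set factor := [set cls c | c in P].

Lemma ipos_cls x : ipos (cls x) <-> P x.
Proof.
split=> [[c Pc] /clsP[t Tt ->]|Px]; last by exists x.
exact: (ordM Pc (T_pos Tt)).
Qed.

Lemma iposD : hsum qadd ipos ipos `<=` ipos.
Proof.
move=> C [_ [x Px <-]] [_ [y Py <-]]; rewrite qadd_cls => -[t [u [Tt Tu ->]]].
apply/ipos_cls; apply: (@ordD _ oP).
exists (x * t); first exact: (ordM Px (T_pos Tt)).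
by exists (y * u); [exact: (ordM Py (T_pos Tu))|].
Qed.

Lemma iposM A B : ipos A -> ipos B -> ipos (qmul A B).
Proof.
move=> [x Px <-] [y Py <-]; rewrite qmul_cls; apply/ipos_cls.
exact: (ordM Px Py).
Qed.

Lemma ipos_disj : ipos `&` [set qopp A | A in ipos] = set0.
Proof.
apply/seteqP; split=> // A [/= pA [_ [x Px <-] eA]]; exfalso.
move: pA; rewrite -eA qopp_cls => /ipos_cls Pnx.
suff : (set0 : set K) (- x) by [].
by rewrite -(ord_disj oP); split=> //; exists x.
Qed.

Lemma ipos_cover :
  ipos `|` [set qopp A | A in ipos] = [set A | A <> qzero].
Proof.
have cov x : (x <> 0) = (P x \/ exists2 y, P y & - y = x).
  by have /(congr1 (fun S : set K => S x)) := ord_cover oP.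
apply/seteqP; split=> A.
  case=> [[x Px <-]|[_ [x Px <-] <-]]; rewrite ?qopp_cls => /cls_eq0.
    by apply/(_ : x <> 0); rewrite cov; left.
  by apply/(_ : - x <> 0); rewrite cov; right; exists x.
rewrite -(repK A) => A0.
have : rep A <> 0 by move=> r0; apply: A0; rewrite r0.
rewrite cov => -[Px|[y Py <-]]; first by left; apply/ipos_cls.
by right; exists (cls y); [apply/ipos_cls|rewrite qopp_cls].
Qed.

Definition induced_ordering : ordering factor :=
  @Ordering factor ipos iposD iposM ipos_disj ipos_cover.

End Factor.

(** * The subgroup of positive units of a valued ordered field *)

Section PosUnits.
Variables (K : fieldType) (G : orderedGroupType).
Variables (v : valuation (field_hyper K) G) (oP : ordering (field_hyper K)).
Local Notation P := (positive oP).
Implicit Types x y : K.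

Definition pos_units_set : set K := P `&` val_units v.

Lemma fpos_cover x : (x <> 0) = (P x \/ exists2 y, P y & - y = x).
Proof. by have /(congr1 (fun S : set K => S x)) := ord_cover oP. Qed.

Lemma fpos_disj x : P x -> P (- x) -> False.
Proof.
move=> Px Pnx; suff : (set0 : set K) (- x) by [].
by rewrite -(ord_disj oP); split=> //; exists x.
Qed.

Lemma fpos0 : ~ P (0 : K).
Proof. by move=> P0; apply: (fpos_disj P0); rewrite oppr0. Qed.

Lemma fpos1 : P (1 : K).
Proof.
have := @fone_neq0 K; rewrite fpos_cover => -[//|[y Py e]].
have <- : y * y = 1 by rewrite -mulrNN e mulr1.
exact: (ordM Py Py).
Qed.

Lemma fvalM x y : v (x * y)%R = vadd (v x) (v y).
Proof. exact: valM. Qed.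

Lemma fval1 : v (1%R : K) = Some 0.
Proof.
have := fvalM 1 1; rewrite mulr1.
case e : (v (1%R : K)) => [g|] /=.
  by move=> [] /esym /eqP; rewrite -subr_eq0 addrK => /eqP ->.
by move/val_oo: e => /fone_neq0.
Qed.

Lemma pos_units0 : ~ pos_units_set 0.
Proof. by case=> /fpos0. Qed.

Lemma pos_units1 : pos_units_set 1.
Proof. by split; [exact: fpos1|exact: fval1]. Qed.

Lemma pos_unitsM x y :
  pos_units_set x -> pos_units_set y -> pos_units_set (x * y).
Proof.
move=> [Px vx] [Py vy]; split; first exact: (ordM Px Py).
by rewrite /val_units /= fvalM vx vy /= addr0.
Qed.

Lemma pos_unitsV x : pos_units_set x -> pos_units_set x^-1.
Proof.
move=> [Px vx].
have x0 : x != 0 by apply/eqP => x0; apply: fpos0; rewrite -x0.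
split.
  have : x^-1 <> 0 by apply/eqP; rewrite invr_eq0.
  rewrite fpos_cover => -[//|[y Py e]].
  have := ordM Px Py => /= Pxy; exfalso; apply: (fpos_disj fpos1).
  suff -> : - 1 = x * y :> K by [].
  by apply: oppr_inj; rewrite opprK -mulrN e divff.
have := fvalM x x^-1; rewrite divff// fval1 vx /val_units /=.
by case: (v (x^-1)%R) => //= g []; rewrite add0r => <-.
Qed.

Definition pos_units : mulSubgroup K :=
  MulSubgroup pos_units0 pos_units1 pos_unitsM pos_unitsV.

Lemma pos_units_val : subgroup_set pos_units `<=` val_units v.
Proof. by move=> x []. Qed.

Lemma pos_units_pos : subgroup_set pos_units `<=` P.
Proof. by move=> x []. Qed.

End PosUnits.

(* Main.v *)
Require Import Defs.
From mathcomp Require Import all_boot all_order all_algebra.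
From mathcomp Require Import boolp classical_sets.
From mathcomp Require Import ring.

(** Compatibility passes between [v] and [vT] because [T] consists of positive
    units: an element [t + m * u] of the hypersum of the classes of [1] and [m]
    is [t * (1 + m * u / t)], with [m * u / t] again in the valuation ideal and
    [t] positive, so its sign is that of an element of [1 + M] (Lemma
    [induced_compatible]).

    If [v] is not compatible with [P], some [1 + m] with [v m > 0] fails to be
    positive, so [a = - m] satisfies [a > 1] and [v a > 0] (Lemma
    [incompatible_gt1]). When [v] has rank 1, high powers of [a] absorb every
    negative value: for [c > 0] there is [n] with [v (c * a ^+ n.+1) > 0], and
    then [1 + c * a ^+ n.+1] is a positive unit which exceeds [c]. The positive
    units are thus cofinal in [K] (Lemma [pos_units_cofinal]).

    Cofinality of [T] destroys the order on [K_T]: for positive [x] and [y], the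
    hyperdifference of the classes of [y] and [x] contains the class of
    [y - x * u] for each [u] in [T], and this is negative once [u > y / x]
    (Lemma [cofinal_incomparable]). Elements strictly between two others must be
    [0] when positive elements are pairwise incomparable, since [a < x < b] with
    [x > 0] forces [b > 0], and with [x < 0] gives the positive pair
    [- x < - a]. Hence every set containing [0] is convex, in particular the
    valuation ring. *)

Set Implicit Arguments.
Unset Strict Implicit.
Unset Printing Implicit Defensive.

Import Order.TTheory GRing.Theory Num.Theory.

Local Open Scope classical_set_scope.
Local Open Scope ring_scope.

(** * Ordered groups *)

Section OrderedGroupFacts.
Variable G : orderedGroupType.
Implicit Types g h : G.

Lemma og_ltD2r g h k : g < h -> g + k < h + k.
Proof.
rewrite !lt_neqAle => /andP[gh /og_leD2r ->]; rewrite andbT.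
by apply: contra gh => /eqP /addIr ->.
Qed.

Lemma og_add_self_eq0 g : g + g = 0 -> g = 0.
Proof.
move=> gg; apply/eqP; rewrite eq_le.
by case/orP: (og_total g 0) => g0; have := og_leD2r _ _ g g0;
  rewrite gg add0r => ->; rewrite g0.
Qed.

Lemma vlt_Some g h : vlt (Some g) (Some h) = (g < h).
Proof.
rewrite /vlt /=; apply/idP/idP => [nhg|/lt_geF -> //].
rewrite lt_neqAle; case/orP: (og_total g h) => [gh|hg]; last by rewrite hg in nhg.
by rewrite gh andbT; apply: contra nhg => /eqP ->.
Qed.

End OrderedGroupFacts.

(** * Orderings of hyperfields *)

Section HyperOrder.
Variables (F : hyperfieldType) (P : ordering F).
Implicit Types x y a b : F.

Lemma hoppK x : (- - x)%H = x.
Proof. by apply/esym/haddN_uniq; rewrite haddC; exact: haddN. Qed.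

Lemma hlt_pos x b : positive P x -> hlt P x b -> positive P b.
Proof.
move=> Px xb; have [w wbx] := hadd_nonempty b (- x)%H.
have Pw := xb _ wbx.
move: wbx; rewrite haddC => /hadd_rev; rewrite hoppK => bwx.
by apply: (@ordD _ P); exists w => //; exists x.
Qed.

(** Nothing but [0] lies strictly between two elements: a positive [x] below
    [b] forms a positive comparable pair with [b], and a negative [x] above [a]
    gives such a pair after negation. *)
Lemma incomparable_convex (C : set F) :
  (forall x y, positive P x -> positive P y -> ~ hlt P x y) ->
  C 0%H -> order_convex P C.
Proof.
move=> incomp C0 a b x _ _ ax xb.
have [->//|x0] := EM (x = 0%H).
have : (positive P `|` [set (- x)%H | x in positive P]) x by rewrite ord_cover.
case=> [Px|[z Pz zx]]; exfalso.
  exact: incomp Px (hlt_pos Px xb) xb.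
have zNa : hlt P z (- a)%H by rewrite /hlt haddC zx.
exact: incomp Pz (hlt_pos Pz zNa) zNa.
Qed.

End HyperOrder.

(** * Valued ordered fields *)

Section ValuedOrderedField.
Variables (K : fieldType) (G : orderedGroupType).
Variables (v : valuation (field_hyper K) G) (oP : ordering (field_hyper K)).
Local Notation P := (positive oP).
Implicit Types x y c m a u : K.

Lemma fposM x y : P x -> P y -> P (x * y).
Proof. exact: ordM. Qed.

Lemma fposD x y : P x -> P y -> P (x + y).
Proof. by move=> Px Py; apply: (@ordD _ oP); exists x => //; exists y. Qed.

Lemma fpos_neq0 x : P x -> x != 0.
Proof. by move=> Px; apply/eqP => x0; apply: (@fpos0 K oP); rewrite -x0. Qed.

Lemma fposV x : P x -> P x^-1.
Proof.
move=> Px; have : x^-1 <> 0 by apply/eqP; rewrite invr_eq0 fpos_neq0.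
rewrite (fpos_cover oP) => -[//|[y Py e]].
exfalso; apply: (fpos_disj (fpos1 oP)).
by rewrite -(divff (fpos_neq0 Px)) -e mulrN opprK; exact: fposM.
Qed.

Lemma fval_pos x : P x -> exists g, v x = Some g.
Proof.
move=> /fpos_neq0/eqP x0; case e: (v x) => [g|]; first by exists g.
by move/val_oo: e.
Qed.

Lemma fvalN x : v (- x) = v x.
Proof.
have vN1 : v (- 1 : K) = Some 0.
  have := fvalM v (- 1) (- 1); rewrite mulrNN mulr1 fval1.
  by case: (v (- 1 : K)) => //= g [/esym /og_add_self_eq0 ->].
by rewrite -mulN1r fvalM vN1; case: (v x) => //= g; rewrite add0r.
Qed.

Lemma fvalX a g n : v a = Some g -> v (a ^+ n) = Some (g *+ n).
Proof.
move=> va; elim: n => [|n IHn]; first by rewrite expr0 fval1.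
by rewrite exprS fvalM va IHn mulrS.
Qed.

Lemma fvalD x y : vle (vmin (v x) (v y)) (v (x + y)).
Proof. exact: (@valD _ _ v x y). Qed.

(** The value of [1 + m] is nonnegative, and cannot be positive as
    [1 = (1 + m) - m]. *)
Lemma fval_add1 m : vlt (Some 0) (v m) -> v (1 + m) = Some 0.
Proof.
have := fvalD 1 m; have := fvalD (1 + m) (- m).
rewrite addrK fvalN fval1.
case: (v m) => [g|]; case: (v (1 + m)) => [h|] //.
- rewrite vlt_Some /vmin /= => + + g0; rewrite (ltW g0) /= => + h0.
  case: ifP => [_ h0'|_ /le_lt_trans/(_ g0)]; last by rewrite ltxx.
  by congr Some; apply/le_anti/andP.
- by rewrite vlt_Some /vmin /= => /le_lt_trans g0 _ /g0; rewrite ltxx.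
- by rewrite /vmin /= => h0' h0 _; congr Some; apply/le_anti/andP.
Qed.

Lemma compatibleP :
  compatible v oP <-> forall m, vlt (Some 0) (v m) -> P (1 + m).
Proof.
split=> [co m m0|H z [_ -> [m m0 ->]]]; last exact: H.
by apply: co; exists 1 => //; exists m.
Qed.

Lemma incompatible_gt1 :
  ~ compatible v oP -> exists2 a, vlt (Some 0) (v a) & P (a - 1).
Proof.
move=> nco; apply: contrapT => noa; apply/nco/compatibleP => m m0.
have : 1 + m <> 0.
  by move=> e; have := fval_add1 m0; rewrite e (_ : v 0 = None)//; apply/val_oo.
rewrite (fpos_cover oP) => -[//|[y Py e]]; exfalso; apply: noa.
by exists (- m); rewrite ?fvalN// -opprD addrC -e opprK.
Qed.

Lemma fpos_gt1 a : P (a - 1) -> P a.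
Proof. by move=> /fposD/(_ (fpos1 oP)); rewrite subrK. Qed.

Lemma fpos_expn_gt1 a n : P (a - 1) -> P (a ^+ n.+1 - 1).
Proof.
move=> a1; elim: n => [//|n IHn].
have -> : a ^+ n.+2 - 1 = a * (a ^+ n.+1 - 1) + (a - 1) by rewrite exprS; ring.
by apply: fposD => //; apply: fposM => //; exact: fpos_gt1.
Qed.

(** Powers of an element [a > 1] of positive value bring any [c > 0] into the
    valuation ideal without decreasing it; adding [1] then gives a unit. *)
Lemma pos_units_cofinal : rank1 v -> ~ compatible v oP ->
  forall c, P c -> exists2 u, subgroup_set (pos_units v oP) u & P (u - c).
Proof.
move=> [_ arch] /incompatible_gt1[a va a1] c Pc.
have Pa := fpos_gt1 a1.
have [g vag] := fval_pos Pa; have [h vch] := fval_pos Pc.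
have g0 : 0 < g by rewrite vag vlt_Some in va.
have [n hn] : exists n, - h <= g *+ n.
  apply: arch g0; first by exists a => //; exact/eqP/fpos_neq0.
  exists c^-1; first by apply/eqP; rewrite invr_eq0 fpos_neq0.
  have := fvalM v c c^-1; rewrite divff ?fpos_neq0// fval1 vch /=.
  case: (v (c^-1 : K)) => //= k [hk].
  by congr Some; apply: (@addrI _ h); rewrite -hk subrr.
exists (1 + c * a ^+ n.+1); first split.
- apply: fposD; first exact: fpos1.
  by apply: fposM => //; rewrite -(subrK 1 (a ^+ _)); apply: fposD;
    [exact: fpos_expn_gt1 | exact: fpos1].
- apply: fval_add1; rewrite fvalM vch (fvalX n.+1 vag) /= vlt_Some.
  (* Archimedes only gives [0 <= h + g *+ n]; the extra factor [a] makes it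
     strict. *)
  apply: le_lt_trans (_ : g *+ n + h < _).
    by have := og_leD2r _ _ h hn; rewrite addNr.
  by rewrite mulrS addrCA [h + _]addrC -{1}(add0r (_ + h)); exact: og_ltD2r.
- have -> : 1 + c * a ^+ n.+1 - c = 1 + c * (a ^+ n.+1 - 1) by ring.
  by apply: fposD; [exact: fpos1 | apply: fposM => //; exact: fpos_expn_gt1].
Qed.

End ValuedOrderedField.

(** * Factor hyperfields *)

Section FactorOrder.
Variables (K : fieldType) (sT : mulSubgroup K) (oP : ordering (field_hyper K)).
Hypothesis T_pos : subgroup_set sT `<=` positive oP.
Local Notation P := (positive oP).
Local Notation PT := (induced_ordering T_pos).

(** The class of [y - x * u] lies in the hyperdifference of the classes of [y]
    and [x] for every [u] in [T]; it is negative as soon as [u > y / x]. *)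
Lemma cofinal_incomparable :
  (forall c : K, P c -> exists2 u, subgroup_set sT u & P (u - c)) ->
  forall X Y : factor sT, positive PT X -> positive PT Y -> ~ hlt PT X Y.
Proof.
move=> cofin _ _ [x Px <-] [y Py <-] XY.
have [u Tu ugt] := cofin _ (fposM Py (fposV Px)).
have /ipos_cls Pyxu : positive PT (cls sT (y - x * u)).
  apply: XY; rewrite /hopp /= qopp_cls /hadd /= qadd_cls.
  by exists 1, u; split=> //; [exact: subgroup1 | rewrite mulr1 mulNr].
apply: (fpos_disj (Pyxu T_pos)).
have -> : - (y - x * u) = x * (u - y * x^-1).
  by rewrite opprB mulrBr [y * _]mulrC mulrA divff ?mul1r ?(fpos_neq0 Px).
exact: fposM.
Qed.

Variables (G : orderedGroupType) (v : valuation (field_hyper K) G).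
Hypothesis T_units : subgroup_set sT `<=` val_units v.

(** [t + m * u = t * (1 + m * (u / t))], and multiplying by elements of [T]
    changes neither signs nor values. *)
Lemma induced_compatible :
  compatible v oP <-> compatible (induced_valuation T_units) PT.
Proof.
split=> [/compatibleP co C [_ -> [M]]|co].
  rewrite -(repK M); set m := rep M; rewrite /val_ideal /= (ival_cls T_units) => m0.
  rewrite /hadd /= /hone /= /qone qadd_cls => -[t [u [Tt Tu ->]]].
  apply/ipos_cls => //.
  have -> : 1 * t + m * u = t * (1 + m * (u * t^-1)).
    by rewrite mul1r mulrDr mulr1 mulrCA [u * _]mulrC mulVKf ?(subgroup_neq0 Tt).
  apply: fposM; first exact: T_pos.
  apply: co; rewrite fvalM.
  have -> : v (u * t^-1) = Some 0.
    by apply: T_units; apply: subgroupM => //; exact: subgroupV.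
  by case: (v m) m0 => //= g; rewrite addr0.
apply/compatibleP => m m0; apply/(ipos_cls T_pos)/co.
exists (cls sT 1) => //; exists (cls sT m).
  by rewrite /val_ideal /= (ival_cls T_units).
rewrite /hadd /= qadd_cls; exists 1, 1.
by split; rewrite ?mulr1//; exact: subgroup1.
Qed.

End FactorOrder.

Theorem proposition5p11 (K : fieldType) (G : orderedGroupType)
    (v : valuation (field_hyper K) G) (P : ordering (field_hyper K)) :
  let T : mulSubgroup K := pos_units v P in
  let vT : valuation (factor T) G :=
    induced_valuation (@pos_units_val K G v P) in
  let PT : ordering (factor T) :=
    induced_ordering (@pos_units_pos K G v P) in
  (compatible v P <-> compatible vT PT) /\
  (rank1 v -> ~ compatible v P ->
     [/\ (forall x y : factor T, positive PT x -> positive PT y -> ~ hcomparable PT x y),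
         order_convex PT (val_ring vT)
       & ~ compatible vT PT]).
Proof.
move=> T vT PT.
have compE : compatible v P <-> compatible vT PT by exact: induced_compatible.
split=> // rk nco.
have incomp : forall x y : factor T,
    positive PT x -> positive PT y -> ~ hlt PT x y.
  by apply: cofinal_incomparable => c; exact: pos_units_cofinal.
split; last by move/compE.
- by move=> x y Px Py [/(incomp _ _ Px Py)|/(incomp _ _ Py Px)].
- apply: incomparable_convex incomp _.
  by rewrite /val_ring /mkset (_ : vT 0%H = None) //; exact/val_oo.
Qed.
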